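(* Let $\tilde p$ be an integer and $\tilde q$ a positive integer with $\tilde q \geqslant 97\,|\tilde p|$. Consider the polynomial in $t$ $$P(t)=Q_{p\,q}(t)\quad\text{with } p=\tilde p+\tilde q,\ q=\tilde q,$$ where $$Q_{p q}(t)=t^{10}+(2q^2+p^2)(3q^2-2p^2)t^8+(q^8+10p^2q^6+4p^4q^4-14p^6q^2+p^8)t^6-p^2q^2(q^8-14p^2q^6+4p^4q^4+10p^6q^2+p^8)t^4-p^6q^6(q^2+2p^2)(3p^2-2q^2)t^2-q^{10}p^{10}.$$ Put $A=\tilde q^{2}+5\tilde p\tilde q+10\tilde p^{2}$. Then $P$ has at least one real root $t$ satisfying: (i) $A-\dfrac{74|\tilde p|^3}{\tilde q}<t<A$ if $\tilde p>0$; (ii) $A<t<A+\dfrac{74|\tilde p|^3}{\tilde q}$ if $\tilde p<0$; (iii) $t=\tilde q^{2}$ if $\tilde p=0$. *)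

(* Defs.v *)
From HB Require Import structures.
From mathcomp Require Import all_boot all_order all_algebra.
From mathcomp Require Import reals.

Set Implicit Arguments.
Unset Strict Implicit.
Unset Printing Implicit Defensive.

Import Order.TTheory GRing.Theory Num.Theory.

Local Open Scope ring_scope.

Definition Qpoly (p q : int) : {poly int} :=
  'X^10
  + ((2 * q ^+ 2 + p ^+ 2) * (3 * q ^+ 2 - 2 * p ^+ 2)) *: 'X^8
  + (q ^+ 8 + 10 * p ^+ 2 * q ^+ 6 + 4 * p ^+ 4 * q ^+ 4
     - 14 * p ^+ 6 * q ^+ 2 + p ^+ 8) *: 'X^6
  - (p ^+ 2 * q ^+ 2
     * (q ^+ 8 - 14 * p ^+ 2 * q ^+ 6 + 4 * p ^+ 4 * q ^+ 4
        + 10 * p ^+ 6 * q ^+ 2 + p ^+ 8)) *: 'X^4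
  - (p ^+ 6 * q ^+ 6 * (q ^+ 2 + 2 * p ^+ 2) * (3 * p ^+ 2 - 2 * q ^+ 2))
    *: 'X^2
  - (q ^+ 10 * p ^+ 10)%:P.

Definition Acoef (pt qt : int) : int :=
  qt ^+ 2 + 5 * pt * qt + 10 * pt ^+ 2.

(* Main.v *)
Require Import Defs.
From mathcomp Require Import all_boot all_order all_algebra.
From mathcomp Require Import reals.
From mathcomp Require Import polyrcf ring lra.

Import Order.TTheory GRing.Theory Num.Theory.

Local Open Scope ring_scope.

(** The polynomial is homogeneous once [t] is given weight two: with
    [x = pt / qt] and [t = qt ^+ 2 * tau], it equals [qt ^+ 20] times a
    polynomial in [s = tau ^+ 2] and [w = (1 + x) ^+ 2].  Along
    [s = 1 + 10 x + 45 x ^+ 2 + e x ^+ 3] this polynomial is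
    [x ^+ 3 * (16 e - 384 + x * r)], where [r] is bounded for bounded [e].
    The ends [tau = 1 + 5 x + 10 x ^+ 2] and
    [tau = 1 + 5 x + 10 x ^+ 2 - 74 x ^+ 3] of the interval correspond to
    [e] close to [100] and to [-48], which makes [16 e - 384 + x * r] positive
    and negative respectively, so the intermediate value theorem applies. *)

Definition Qred {R : comNzRingType} (s w : R) : R :=
  s ^+ 5 + (2 + w) * (3 - 2 * w) * s ^+ 4
  + (1 + 10 * w + 4 * w ^+ 2 - 14 * w ^+ 3 + w ^+ 4) * s ^+ 3
  - w * (1 - 14 * w + 4 * w ^+ 2 + 10 * w ^+ 3 + w ^+ 4) * s ^+ 2
  - w ^+ 3 * (1 + 2 * w) * (3 * w - 2) * s - w ^+ 5.

(* Numerals are unary, hence the large coefficients are split in base 1000. *)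
Definition Qred_remainder {R : comNzRingType} (x e : R) : R :=
  2016 + 320 * e
  + x * ((94 * 1000 + 400) + 3968 * e
  + x * ((1191 * 1000 + 520) + (32 * 1000 + 32) * e + 32 * e ^+ 2
  + x * ((7732 * 1000 + 416) + (206 * 1000 + 632) * e + 480 * e ^+ 2
  + x * (((31 * 1000 + 679) * 1000 + 232) + (999 * 1000 + 440) * e + 4816 * e ^+ 2
  + x * (((73 * 1000 + 237) * 1000 + 800) + (3776 * 1000 + 384) * e + (29 * 1000 + 24) * e ^+ 2 + 24 * e ^+ 3
  + x * (((83 * 1000 + 907) * 1000 + 372) + (9032 * 1000 + 872) * e + (134 * 1000 + 824) * e ^+ 2 + 240 * e ^+ 3
  + x * (- ((42 * 1000 + 94) * 1000 + 880) + ((12 * 1000 + 721) * 1000 + 849) * e + (373 * 1000 + 360) * e ^+ 2 + 1840 * e ^+ 3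
  + x * (- (6540 * 1000 + 760) - (3548 * 1000 + 860) * e + (688 * 1000 + 168) * e ^+ 2 + 6440 * e ^+ 3 + 8 * e ^+ 4
  + x * ((768 * 1000 + 600) - (626 * 1000 + 938) * e - (111 * 1000 + 536) * e ^+ 2 + (17 * 1000 + 446) * e ^+ 3 + 40 * e ^+ 4
  + x * ((89 * 1000 + 100) + (50 * 1000 + 380) * e - (22 * 1000 + 222) * e ^+ 2 - 1548 * e ^+ 3 + 212 * e ^+ 4
  + x * (5985 * e + 1100 * e ^+ 2 - 346 * e ^+ 3 - 8 * e ^+ 4 + e ^+ 5
  + x * (134 * e ^+ 2 + 8 * e ^+ 3 - 2 * e ^+ 4
  + x * (e ^+ 3))))))))))))).

(** At [s = w = 1] there is a root in [s] that is simple, with derivative 16. The quadratic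
    [1 + 10 x + 45 x ^+ 2] follows its branch to second order, so lower powers of [x] cancel; the
    next coefficient of the branch is [e = 24]. *)
Lemma Qred_expansion (R : comNzRingType) (x e : R) :
  Qred (1 + 10 * x + 45 * x ^+ 2 + e * x ^+ 3) ((1 + x) ^+ 2)
  = x ^+ 3 * (16 * e - 384 + x * Qred_remainder x e).
Proof. by rewrite /Qred /Qred_remainder; ring. Qed.

Section NormBounds.
Variable R : realFieldType.
Implicit Types a b A B : R.

Lemma norm_add_le a b A B : `|a| <= A -> `|b| <= B -> `|a + b| <= A + B.
Proof. by move=> hA hB; apply: le_trans (ler_normD _ _) (lerD hA hB). Qed.

Lemma norm_mul_le a b A B : `|a| <= A -> `|b| <= B -> `|a * b| <= A * B.
Proof. by move=> hA hB; rewrite normrM ler_pM. Qed.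

Lemma norm_exp_le a A n : `|a| <= A -> `|a ^+ n| <= A ^+ n.
Proof. by move=> hA; rewrite normrX lerXn2r ?nnegrE ?(le_trans _ hA). Qed.

Lemma norm_opp_le a A : `|a| <= A -> `|- a| <= A.
Proof. by rewrite normrN. Qed.

Lemma norm_nat_le n : `|n%:R : R| <= n%:R.
Proof. by rewrite normr_nat. Qed.

(** The bound 103 covers both values of [e] used below. Then [x * r] stays below 516 in absolute
    value, while [16 * e - 384] exceeds 1199 at one end and is at most -1040 at the other. *)
Lemma Qred_remainder_bound (x e : R) :
  `|x| <= 97^-1 -> `|e| <= 103 -> `|Qred_remainder x e| <= 50 * 1000.
Proof.
move=> hx he; rewrite /Qred_remainder; apply: le_trans.
  (* The intermediate bound is an existential variable, built by following the syntax of the Horner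
     form; [lra] is left with a closed numerical inequality. *)
  repeat first [exact: hx | exact: he | exact: norm_nat_le
    | apply: norm_opp_le | apply: norm_exp_le
    | apply: norm_mul_le | apply: norm_add_le].
lra.
Qed.

(** The extra factor [x] turns [x ^+ 3] into [x ^+ 4], so both signs of [x] are treated at once. *)
Lemma Qred_quadratic_sign (x : R) : `|x| <= 97^-1 -> x != 0 ->
  0 < x * Qred ((1 + 5 * x + 10 * x ^+ 2) ^+ 2) ((1 + x) ^+ 2).
Proof.
move=> hx x0; pose e : R := 100 + 100 * x.
have := hx; rewrite ler_norml => /andP[hx1 hx2].
have he : `|e| <= 103 by rewrite ler_norml /e; apply/andP; split; lra.
have := norm_mul_le _ _ _ _ hx (Qred_remainder_bound _ _ hx he).
rewrite ler_norml => /andP[hr _].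
rewrite [X in Qred X _](_ : _ = 1 + 10 * x + 45 * x ^+ 2 + e * x ^+ 3);
  last by rewrite /e; ring.
rewrite Qred_expansion mulrA -exprS mulr_gt0 ?exprn_even_gt0 //.
move: hr; rewrite /e; lra.
Qed.

Lemma Qred_cubic_sign (x : R) : `|x| <= 97^-1 -> x != 0 ->
  x * Qred ((1 + 5 * x + 10 * x ^+ 2 - 74 * x ^+ 3) ^+ 2) ((1 + x) ^+ 2) < 0.
Proof.
move=> hx x0.
(* This is [100 + 100 x - 148 (1 + 5 x + 10 x ^+ 2) + 5476 x ^+ 3], from expanding the square. *)
pose e : R := - 48 + x * (- 640 + x * (- 1480 + x * 5476)).
have hd : `|e + 48| <= 7.
  rewrite /e addrC addNKr; apply: le_trans.
    repeat first [exact: hx | exact: norm_nat_le | apply: norm_opp_le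
      | apply: norm_mul_le | apply: norm_add_le].
  lra.
have he : `|e| <= 103.
  by move: hd; rewrite !ler_norml => /andP[h1 h2]; apply/andP; split; lra.
have := norm_mul_le _ _ _ _ hx (Qred_remainder_bound _ _ hx he).
rewrite ler_norml => /andP[_ hr].
rewrite [X in Qred X _](_ : _ = 1 + 10 * x + 45 * x ^+ 2 + e * x ^+ 3);
  last by rewrite /e; ring.
rewrite Qred_expansion mulrA -exprS pmulr_rlt0 ?exprn_even_gt0 //.
move: hd hr; rewrite ler_norml => /andP[_ hd] hr; lra.
Qed.

End NormBounds.

Lemma horner_Qpoly (R : realFieldType) (p q : int) (tau : R) : q != 0 ->
  (map_poly (intr : int -> R) (Qpoly p q)).[q%:~R ^+ 2 * tau]
  = q%:~R ^+ 20 * Qred (tau ^+ 2) ((p%:~R / q%:~R) ^+ 2).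
Proof.
move=> q0; have Q0 : q%:~R != 0 :> R by rewrite intr_eq0.
rewrite /Qpoly !(rmorphD, rmorphB, rmorphN) /= !map_polyZ /=.
rewrite !map_polyXn map_polyC /=.
rewrite !(hornerD, hornerN, hornerZ, hornerXn, hornerC).
rewrite !(rmorphD, rmorphB, rmorphM, rmorphXn, rmorphN) /=.
by rewrite /Qred; field.
Qed.

Theorem theorem4p1 (R : realType) (pt qt : int)
    (hq : 0 < qt) (hpq : 97 * `|pt| <= qt) :
  exists t : R,
    [/\ root (map_poly (intr : int -> R) (Qpoly (pt + qt) qt)) t,
        0 < pt ->
          (Acoef pt qt)%:~R - 74 * (`|pt| ^+ 3)%:~R / qt%:~R < t
          /\ t < (Acoef pt qt)%:~R,
        pt < 0 ->
          (Acoef pt qt)%:~R < t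
          /\ t < (Acoef pt qt)%:~R + 74 * (`|pt| ^+ 3)%:~R / qt%:~R
      & pt = 0 -> t = (qt ^+ 2)%:~R].
Proof.
have qt0 : qt != 0 by rewrite gt_eqF.
have q0 : 0 < qt%:~R :> R by rewrite ltr0z.
have qN0 : qt%:~R != 0 :> R by rewrite gt_eqF.
set P := map_poly _ _; set q : R := qt%:~R in q0 qN0 *.
pose x : R := pt%:~R / q.
pose a := 1 + 5 * x + 10 * x ^+ 2; pose b := a - 74 * x ^+ 3.
have PE tau : P.[q ^+ 2 * tau] = q ^+ 20 * Qred (tau ^+ 2) ((1 + x) ^+ 2).
  by rewrite /P horner_Qpoly // rmorphD /= -/q mulrDl divff // addrC.
have AE : (Acoef pt qt)%:~R = q ^+ 2 * a :> R.
  rewrite /Acoef !(rmorphD, rmorphM, rmorphXn) /= -/q /a /x; by field.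
have xq : pt%:~R = x * q by rewrite /x mulfVK.
have hx : `|x| <= 97^-1.
  rewrite /x normrM normfV (gtr0_norm q0) ler_pdivrMr // ler_pdivlMl //.
  by rewrite -intr_norm -(ler_int R) rmorphM /= in hpq *.
have DE : 74 * (pt ^+ 3)%:~R / q = q ^+ 2 * (74 * x ^+ 3).
  by rewrite rmorphXn /= xq; field.
have q2 : 0 < q ^+ 2 by rewrite exprn_gt0.
have ab : x != 0 -> P.[q ^+ 2 * a] * P.[q ^+ 2 * b] < 0.
  move=> x0; have := Qred_quadratic_sign _ _ hx x0; have := Qred_cubic_sign _ _ hx x0.
  rewrite -/a -/b !PE => hb ha.
  rewrite mulrACA pmulr_rlt0 ?mulr_gt0 ?exprn_gt0 //.
  (* The factor [x ^+ 2] is shared out, one [x] to each value of [Qred], to match the two sign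
     lemmas. *)
  rewrite -(pmulr_rlt0 _ (_ : 0 < x ^+ 2)) ?exprn_even_gt0 //.
  by rewrite expr2 mulrACA pmulr_rlt0.
case: (ltrgtP pt 0) => [pt0|pt0|pt0].
- have x0 : x < 0 by rewrite pmulr_llt0 ?invr_gt0 // ltrz0.
  have x3 : x ^+ 3 < 0 by rewrite exprn_odd_lt0.
  (* For negative [x] the term [- 74 * x ^+ 3] is positive, so [a] gives the left end. *)
  have le_ab : q ^+ 2 * a <= q ^+ 2 * b by rewrite ler_pM2l // /b; lra.
  have [|t tab rt] := @poly_ivtoo _ P _ _ le_ab; first by rewrite ab // lt_eqF.
  move: tab; rewrite inE => /andP[ta tb].
  exists t; split=> //; last by move=> h; rewrite h ltxx in pt0.
  move=> _; rewrite AE ltr0_norm // (_ : (- pt) ^+ 3 = - pt ^+ 3); last by ring.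
  by rewrite rmorphN mulrN mulNr DE -mulrBr.
- have x0 : 0 < x by rewrite mulr_gt0 ?invr_gt0 // ltr0z.
  have x3 : 0 < x ^+ 3 by rewrite exprn_gt0.
  have le_ba : q ^+ 2 * b <= q ^+ 2 * a by rewrite ler_pM2l // /b; lra.
  have [|t tba rt] := @poly_ivtoo _ P _ _ le_ba; first by rewrite mulrC ab // gt_eqF.
  move: tba; rewrite inE => /andP[tb ta].
  exists t; split=> //; last by move=> h; rewrite h ltxx in pt0.
  by move=> _; rewrite AE gtr0_norm // DE -mulrBr.
- exists (q ^+ 2); split; rewrite ?pt0 ?ltxx //; last by rewrite rmorphXn.
  (* Here [tau = 1] and [x = 0]: this is the base root [s = w = 1]. *)
  rewrite rootE -[q ^+ 2]mulr1 PE /x pt0 mul0r /Qred.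
  by apply/eqP; ring.
Qed.
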